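(* For general graphs, SPR has a super-constant lower bound on distortion if and only if for every constant $y\ge 0$, $\mathrm{LSPR}_y$ has a super-constant lower bound on distortion.
   Context: Graphs $G=(V,E,\ell)$ are finite and undirected, with an edge length function $\ell:E\to\mathbb{R}^+$ and a designated set $T\subset V$ of $k$ vertices called terminals; the other vertices are non-terminals. $d_G$ is the shortest-path distance. A minor of $G$ is a graph obtained by a sequence of vertex deletions, edge deletions and edge contractions, where no terminal may be deleted and no two terminals may be contracted together (so every terminal survives; a super-node containing terminal $t$ is identified with $t$); a minor carries its own edge length function $\ell'$. A minor $H=(V',E',\ell')$ of $G$ is an $\alpha$-distance approximating minor ($\alpha$-DAM) of $G$ if $d_G(t,t')\le d_H(t,t')\le\alpha\cdot d_G(t,t')$ for all $t,t'\in T$. For a real constant $y\ge0$, $\mathrm{LSPR}_y$ is the problem: given a graph with $k$ terminals, find a DAM with at most $yk$ non-terminals so as to minimize the distortion $\alpha$. The Steiner Point Removal problem SPR is $\mathrm{LSPR}_0$ (no non-terminals allowed). ''$\mathrm{LSPR}_y$ has a super-constant lower bound on distortion'' means: for every constant $\alpha>0$ there is a graph $G$ with some number $k$ of terminals such that every DAM of $G$ with at most $yk$ non-terminals has distortion larger than $\alpha$, i.e. $G$ has no $\alpha$-DAM with at most $yk$ non-terminals. *)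

(* Defs.v *)
From HB Require Import structures.
From Stdlib Require Import Relation_Operators.
From mathcomp Require Import all_boot all_order all_algebra.
From mathcomp Require Import all_classical all_reals ereal.

Set Implicit Arguments.
Unset Strict Implicit.
Unset Printing Implicit Defensive.

Import Order.TTheory GRing.Theory Num.Theory.

Local Open Scope ring_scope.

(* A finite simple graph, with its vertices taken in an ambient finite type V;
   an edge is the two-element set of its endpoints. Keeping the ambient type
   fixed lets a minor of G live over the same V as G. *)
Record graph (V : finType) : Type := Graph {
  vset : {set V};
  eset : {set {set V}};
  esetP : [forall e in eset, (e \subset vset) && (#|e| == 2)%N]
}.

Record wgraph (R : realType) (V : finType) : Type := WGraph {
  wg_graph :> graph V;
  elen : {set V} -> R;  (* only the values on edges are meaningful *)
  elen_gt0 : forall e : {set V}, e \in eset wg_graph -> 0 < elen e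
}.

Definition adj (V : finType) (G : graph V) : rel V :=
  fun x y => [set x; y] \in eset G.

Definition walk_len (R : realType) (V : finType) (G : wgraph R V)
    (x : V) (p : seq V) : R :=
  \sum_(r <- pairmap (fun a b => elen G [set a; b]) x p) r.

(* The distance is +oo between distinct connected components. *)
Definition dist (R : realType) (V : finType) (G : wgraph R V) (x y : V)
    : \bar R :=
  ereal_inf [set (walk_len G x p)%:E | p in
    [set p : seq V | path (adj G) x p /\ last x p = y]]%classic.

Definition merge (V : finType) (u v : V) : V -> V :=
  fun x => if x == v then u else x.

(* Contracting uv keeps the name u for the new super-node. Since v is required
   to be a non-terminal, two terminals are never contracted together and a
   super-node containing a terminal t is named t. Loops created by the
   contraction are dropped and parallel edges are identified. *)
Inductive minor_step (V : finType) (T : {set V}) (G H : graph V) : Prop :=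
| DelVertex (v : V) of v \in vset G & v \notin T
    & vset H = vset G :\ v
    & eset H = [set e in eset G | v \notin e]
| DelEdge (e : {set V}) of e \in eset G
    & vset H = vset G
    & eset H = eset G :\ e
| ContractEdge (u v : V) of [set u; v] \in eset G & v \notin T
    & vset H = vset G :\ v
    & eset H = [set merge u v @: e | e : {set V} in eset G
                                   & #|merge u v @: e| == 2%N].

Definition minor (V : finType) (T : {set V}) (H G : graph V) : Prop :=
  clos_refl_trans (graph V) (minor_step T) G H.

(* The lengths of H are unrelated to those of G. *)
Definition is_DAM (R : realType) (V : finType) (T : {set V}) (alpha : R)
    (G H : wgraph R V) : Prop :=
  minor T H G /\
  forall t t' : V, t \in T -> t' \in T ->
    (dist G t t' <= dist H t t')%E /\
    (dist H t t' <= alpha%:E * dist G t t')%E.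

Definition LSPR_superconstant (R : realType) (y : R) : Prop :=
  forall alpha : R, 0 < alpha ->
  exists (V : finType) (G : wgraph R V) (T : {set V}),
    T \subset vset G /\
    ~ exists H : wgraph R V,
        is_DAM T alpha G H /\ #|vset H :\: T|%:R <= y * #|T|%:R.

Definition SPR_superconstant (R : realType) : Prop :=
  LSPR_superconstant (0 : R).

(* Main.v *)
(** Given [y], [alpha] and a graph [G0] witnessing the SPR lower bound for
    [alpha], glue many copies of [G0] along their terminals only, so that the
    number of copies exceeds [y] times the number of terminals: a minor of the
    glued graph with at most [y * k] non-terminals then has a copy [e] left
    without non-terminals. The part of the minor lying in [e] is a minor of
    [G0], because each minor operation acts inside a single copy, two copies
    sharing at most one vertex.

    Distances survive the restriction to [e] because the copies form a hypergraph
    of large girth: a walk between terminals of [e] either retracts into [e]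
    without getting longer, or traverses so many other copies that it is longer
    than [alpha] times the diameter of [G0].

    The girth comes from involutions [s (j, x)] of a finite group without short
    relations (translations on a ball of a free product of copies of Z/2): the
    terminal [x] of the copy [(g, j)] is the group element [g * s (j, x)]. There
    are [q] copies per group element, where [q > y]. *)

Require Import Defs.
From Stdlib Require Import Relation_Operators.
From mathcomp Require Import all_boot all_order all_algebra all_fingroup.
From mathcomp Require Import all_classical all_reals ereal.
From mathcomp Require Import fintype finset.
From mathcomp Require Import lra.
Set Implicit Arguments.
Unset Strict Implicit.
Unset Printing Implicit Defensive.
Import Order.TTheory GRing.Theory Num.Theory.
Local Open Scope ring_scope.

(** * Involutions without short relations *)

Section Words.

Variable C : eqType.
Implicit Types (c : C) (w u : seq C).

Definition reduced w := sorted (fun a b => a != b) w.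

(** Multiplication by the letter [c] in the free product of copies of Z/2, on normal forms: each
    generator is its own inverse, so [c] cancels an equal head. *)
Definition push c w :=
  if w is c' :: w' then if c == c' then w' else c :: w else [:: c].

Lemma push_reduced c w : reduced w -> reduced (push c w).
Proof.
case: w => [|c' w] //= red_w; case: ifPn => [_|]; first exact: path_sorted red_w.
by move=> ne; rewrite /= ne.
Qed.

Lemma pushK c w : reduced w -> push c (push c w) = w.
Proof.
case: w => [|c' w] /=; first by rewrite eqxx.
case: (eqVneq c c') => [<-|ne] red_w; last by rewrite /= eqxx.
by case: w red_w => [|d w] //= /andP[/negPf ->].
Qed.

(* Traversing a copy multiplies the current word by two letters. Words are
   stored in reverse, so that [b] is the first letter: it can change only if the
   word consists of it alone. *)
Lemma push_push_rcons c c' u b : ~~ odd (size u) ->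
  (u = [::] /\ c = b /\ push c' (push c (rcons u b)) = [:: c']) \/
  exists2 u', push c' (push c (rcons u b)) = rcons u' b &
    ~~ odd (size u') /\ (size u' <= size u + 2)%N.
Proof.
case: u => [|c1 [|c2 u]] //= ev_u.
  case: eqVneq => [->|ne]; first by left.
  right; rewrite /push; case: ifP => _; first by exists [::].
  by exists [:: c'; c].
rewrite negbK in ev_u; right.
case: eqVneq => [_|ne] /=; case: ifP => _.
- by exists u; rewrite //= addn2 !leqW.
- by exists (c' :: c2 :: u); rewrite //= negbK leq_addr.
- by exists (c1 :: c2 :: u); rewrite //= negbK leq_addr.
- by exists (c' :: c :: c1 :: c2 :: u); rewrite //= addn2 !negbK.
Qed.

Variable gT : finGroupType.
Variable s : C -> gT.

(** The head of a word is the rightmost factor, so that [push] becomes multiplication on the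
    right. *)
Definition word_val w : gT := foldr (fun c g => g * s c)%g 1%g w.

Lemma word_val_push c w :
  (s c * s c = 1)%g -> word_val (push c w) = (word_val w * s c)%g.
Proof.
move=> inv; case: w => [|c' w] //=; case: (eqVneq c c') => [<-|//].
by rewrite -mulgA inv mulg1.
Qed.

End Words.

(** * Permutations of a ball in the free product *)

Section InvolutionGroup.

Variables (C : finType) (L : nat).
Implicit Types (c : C) (w : seq C) (b : L.-bseq C).

(* Left translation by c on the ball of radius L in the free product of copies
   of Z/2 indexed by C; words leaving the ball, and junk words, stay fixed. *)
Definition toggle c w :=
  if reduced w && (size (push c w) <= L)%N then push c w else w.

Lemma size_toggle c w : (size w <= L)%N -> (size (toggle c w) <= L)%N.
Proof. by rewrite /toggle; case: ifP => // /andP[]. Qed.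

Definition ball_toggle c b : L.-bseq C := Bseq (size_toggle c (size_bseq b)).

(** A pushed word is reduced and pushes back to [b], which fits in the ball; a word failing the test
    is fixed both times. *)
Lemma ball_toggleK c : involutive (ball_toggle c).
Proof.
move=> b; apply: val_inj => /=; rewrite {2}/toggle.
case: ifPn => [/andP[red_b sz]|/negPf no]; last by rewrite /toggle no.
by rewrite /toggle push_reduced //= pushK // size_bseq.
Qed.

Definition ball_perm c : {perm L.-bseq C} := perm (can_inj (ball_toggleK c)).

Lemma ball_perm_sq c : (ball_perm c * ball_perm c = 1)%g.
Proof. by apply/permP => b; rewrite permM !permE ball_toggleK. Qed.

(** Permutations compose from left to right, so the tail is written first and the head is pushed
    last; the intermediate words are suffixes of [w] and stay in the ball. *)
Lemma word_val_ball_nil w : reduced w -> (size w <= L)%N ->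
  val (word_val ball_perm w [bseq]) = w.
Proof.
elim: w => [|c w IH] red_w sz_w /=; first by rewrite perm1.
have red_w' : reduced w by apply: path_sorted red_w.
rewrite permM permE /= IH ?(ltnW sz_w) // /toggle red_w' /=.
have -> : push c w = c :: w.
  by case: w red_w {IH sz_w red_w'} => [|d w] //= /andP[/negPf ->].
by rewrite sz_w.
Qed.

Lemma word_val_ball_inj w w' : reduced w -> reduced w' ->
  (size w <= L)%N -> (size w' <= L)%N ->
  word_val ball_perm w = word_val ball_perm w' -> w = w'.
Proof.
move=> rw rw' sz sz' eq_ww'.
by rewrite -(word_val_ball_nil rw sz) eq_ww' word_val_ball_nil.
Qed.

End InvolutionGroup.

(** * Graphs, minors and walks *)

Section Graphs.

Variable V : finType.
Implicit Types (G H K : graph V) (T : {set V}).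

Lemma graph_eq G H : vset G = vset H -> eset G = eset H -> G = H.
Proof.
case: G H => [vG eG pG] [vH eH pH] /= eqv eqe; subst.
by congr Graph; apply: bool_irrelevance.
Qed.

Lemma edge_subset G f : f \in eset G -> f \subset vset G.
Proof. by move=> fG; have /forall_inP/(_ f fG)/andP[] := esetP G. Qed.

Lemma edge_card G f : f \in eset G -> #|f| = 2%N.
Proof. by move=> fG; have /forall_inP/(_ f fG)/andP[_ /eqP] := esetP G. Qed.

Lemma adj_sym G : symmetric (adj G).
Proof. by move=> x y; rewrite /adj setUC. Qed.

Lemma merge_id (u v : V) (f : {set V}) : v \notin f -> Defs.merge u v @: f = f.
Proof.
move=> vf; rewrite -[RHS]imset_id; apply: eq_in_imset => x xf; rewrite /Defs.merge.
by case: eqP => // eq_xv; rewrite -eq_xv xf in vf.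
Qed.

(** Only contraction needs an argument: the contracted edge connects every vertex to its image under
    [merge], so an edge of [H] lifts to a path of [G]. This is what keeps infinite distances
    infinite in a minor. *)
Lemma minor_step_connect T G H x y :
  minor_step T G H -> connect (adj H) x y -> connect (adj G) x y.
Proof.
move=> stGH; apply: connect_sub => {x y} x y; rewrite /adj.
case: stGH => [v _ _ _ ->|f _ _ ->|u v uv _ _ ->].
- by rewrite inE => /andP[xy _]; apply: connect1.
- by rewrite inE => /andP[_ xy]; apply: connect1.
case/imsetP => f; rewrite inE => /andP[fG /eqP card_mf] eq_xy.
have cm z : connect (adj G) (Defs.merge u v z) z.
  by rewrite /Defs.merge; case: eqP => [->|_]; [apply: connect1 | apply: connect0].
have conn_f : {in f &, forall a b, connect (adj G) a b}.
  move=> a b.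
  have /eqP/cards2P[c [d [_ eq_f]]] := edge_card fG.
  rewrite eq_f !inE; rewrite eq_f in fG.
  case/orP=> /eqP-> /orP[]/eqP->; rewrite ?connect0 //; apply: connect1 => //.
  by rewrite adj_sym.
have sG : connect_sym (adj G) by apply: sym_connect_sym; apply: adj_sym.
have /imsetP[a af ->] : x \in Defs.merge u v @: f by rewrite -eq_xy !inE eqxx.
have /imsetP[b bf ->] : y \in Defs.merge u v @: f by rewrite -eq_xy !inE eqxx orbT.
by rewrite (connect_trans (cm a)) // (connect_trans (conn_f _ _ af bf)) // sG.
Qed.

Lemma minor_connect T G H x y :
  minor T H G -> connect (adj H) x y -> connect (adj G) x y.
Proof.
elim => {G H} [G H stGH|//|G K H _ IHGK _ IHKH].
  exact: minor_step_connect stGH.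
by move=> /IHKH.
Qed.

End Graphs.

(** * Walks, their lengths and distances *)

Section Walks.

Variables (R : realType) (V : finType).
Implicit Types (G : wgraph R V) (x y z : V) (l : R).

Definition has_walk G x y l :=
  exists p, [/\ path (adj G) x p, last x p = y & walk_len G x p = l].

Lemma walk_len_cons G x y p :
  walk_len G x (y :: p) = elen G [set x; y] + walk_len G y p.
Proof. by rewrite /walk_len /= big_cons. Qed.

Lemma walk_len_cat G x p q :
  walk_len G x (p ++ q) = walk_len G x p + walk_len G (last x p) q.
Proof.
elim: p x => [|y p IH] x /=; first by rewrite /walk_len /= big_nil add0r.
by rewrite !walk_len_cons IH addrA.
Qed.

Lemma has_walk_refl G x : has_walk G x x 0.
Proof. by exists [::]; rewrite /walk_len /= big_nil. Qed.

Lemma has_walk_trans G x y z l m :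
  has_walk G x y l -> has_walk G y z m -> has_walk G x z (l + m).
Proof.
move=> [p [pathp lastp <-]] [q [pathq lastq <-]]; exists (p ++ q).
by rewrite cat_path last_cat walk_len_cat lastp pathp.
Qed.

Lemma has_walk_cons G x y z l :
  adj G x y -> has_walk G y z l -> has_walk G x z (elen G [set x; y] + l).
Proof.
by move=> xy [p [pathp lastp <-]]; exists (y :: p); rewrite /= xy walk_len_cons.
Qed.

Lemma walk_len_ge0 G x p : path (adj G) x p -> 0 <= walk_len G x p.
Proof.
elim: p x => [|y p IH] x /=; first by rewrite /walk_len /= big_nil.
by case/andP=> xy /IH p_ge0; rewrite walk_len_cons addr_ge0 // ltW // elen_gt0.
Qed.

Lemma has_walk_ge0 G x y l : has_walk G x y l -> 0 <= l.
Proof. by case=> p [/walk_len_ge0 p_ge0 _ <-]. Qed.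

Lemma dist_le_walk G x y l : has_walk G x y l -> (dist G x y <= l%:E)%E.
Proof. by case=> p [pathp lastp <-]; apply: ereal_inf_lbound; exists p. Qed.

Lemma le_dist G x y (a : \bar R) :
  (forall l, has_walk G x y l -> (a <= l%:E)%E) -> (a <= dist G x y)%E.
Proof.
move=> le_a; apply: le_ereal_inf_tmp => _ [p [pathp lastp] <-].
by apply: le_a; exists p.
Qed.

Lemma dist_lt_walk G x y (a : \bar R) :
  (dist G x y < a)%E -> exists2 l, has_walk G x y l & (l%:E < a)%E.
Proof.
move=> /ereal_inf_lt[_ [p [pathp lastp] <-] lt_a].
by exists (walk_len G x p) => //; exists p.
Qed.

Lemma dist_pinfty G x y : ~~ connect (adj G) x y -> dist G x y = +oo%E.
Proof.
move=> /negP nc; apply/eqP; rewrite -leye_eq.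
apply: le_dist => l [p [pathp lastp _]].
by case: nc; apply/connectP; exists p.
Qed.

Lemma dist_pinfty_connect G x y : dist G x y = +oo%E -> ~~ connect (adj G) x y.
Proof.
move=> eqoo; apply/negP => /connectP[p pathp eqy].
have : (dist G x y <= (walk_len G x p)%:E)%E by apply: dist_le_walk; exists p.
by rewrite eqoo leye_eq.
Qed.

Lemma dist_ge_edge G (d : R) x y :
  (forall f, f \in eset G -> d <= elen G f) -> x != y -> (d%:E <= dist G x y)%E.
Proof.
move=> le_d ne; apply: le_dist => l [[|z p] /= [pathp lastp <-]].
  by rewrite lastp eqxx in ne.
case/andP: pathp => xz pathp.
by rewrite lee_fin walk_len_cons ler_wpDr ?walk_len_ge0 ?le_d.
Qed.

End Walks.

Lemma has_walk_map (R : realType) (V W : finType) (G : wgraph R V)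
    (G' : wgraph R W) (f : V -> W) x y l :
  (forall u v, adj G u v -> adj G' (f u) (f v)) ->
  (forall u v, adj G u v -> elen G' [set f u; f v] = elen G [set u; v]) ->
  has_walk G x y l -> has_walk G' (f x) (f y) l.
Proof.
move=> f_adj f_len [p [+ <- <-]] {y l}.
elim: p x => [|z p IH] x /=.
  by rewrite /walk_len /= big_nil => _; apply: has_walk_refl.
case/andP=> xz /IH walk_p; rewrite walk_len_cons -f_len //.
exact: has_walk_cons (f_adj _ _ xz) walk_p.
Qed.

(** * Restriction of a minor to one copy *)

Section Copies.

Variables (V0 V E : finType) (phi : E -> V0 -> V).
Variables (T0 : {set V0}) (T : {set V}).
Hypothesis phi_inj : forall e, injective (phi e).
Hypothesis phi_terminal : forall e x, (phi e x \in T) = (x \in T0).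
Hypothesis phi_private :
  forall e e' x x', phi e x = phi e' x' -> x \notin T0 -> e = e'.
Hypothesis phi_linear : forall e e' x1 x2 x1' x2',
  phi e x1 = phi e' x1' -> phi e x2 = phi e' x2' -> x1 != x2 -> e = e'.

(** Both points of [f] would be common to the two copies, against [phi_linear]. *)
Lemma copy_unique e e' (a a' : {set V0}) (f : {set V}) :
  #|f| = 2%N -> f \subset phi e @: a -> f \subset phi e' @: a' -> e = e'.
Proof.
move=> /eqP/cards2P[u [v [ne ->]]] /subsetP sub /subsetP sub'.
have uI : u \in [set u; v] by rewrite !inE eqxx.
have vI : v \in [set u; v] by rewrite !inE eqxx orbT.
have [/imsetP[x _ ux] /imsetP[z _ vz]] := (sub u uI, sub v vI).
have [/imsetP[x' _ ux'] /imsetP[z' _ vz']] := (sub' u uI, sub' v vI).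
apply: (@phi_linear e e' x z x' z'); rewrite -?ux -?vz //.
by apply: contraNneq ne => eq_xz; rewrite ux vz eq_xz.
Qed.

Definition in_copies (K : graph V) :=
  forall f, f \in eset K -> exists e (a : {set V0}), f = phi e @: a.

Fact copy_esetP e (K : graph V) :
  [forall a in [set a : {set V0} | phi e @: a \in eset K],
    (a \subset phi e @^-1: vset K) && (#|a| == 2)%N].
Proof.
apply/forall_inP => a; rewrite inE => aK.
rewrite -sub_imset_pre edge_subset //=.
by rewrite -(card_imset _ (@phi_inj e)) (edge_card aK).
Qed.

Definition copy e (K : graph V) : graph V0 := Graph (copy_esetP e K).

Lemma merge_phi e (u v : V0) (a : {set V0}) :
  Defs.merge (phi e u) (phi e v) @: (phi e @: a) = phi e @: (Defs.merge u v @: a).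
Proof.
rewrite -!imset_comp; apply: eq_imset => x /=.
by rewrite /Defs.merge (inj_eq (@phi_inj e)); case: ifP.
Qed.

(** A deletion touches the copy [e] only if the deleted vertex or edge lies in it. A contraction
    removes a non-terminal, which is private to the copy containing the contracted edge, so it is a
    contraction of that copy and invisible in the others. *)
Lemma minor_step_copy e (K K' : graph V) :
  in_copies K -> minor_step T K K' ->
  in_copies K' /\ (copy e K' = copy e K \/ minor_step T0 (copy e K) (copy e K')).
Proof.
move=> inK; case=> [v vK vT eqv eqe|f fK eqv eqe|u v uvK vT eqv eqe].
- split=> [f|]; first by rewrite eqe inE => /andP[/inK].
  have [/existsP[x /eqP eqx]|/existsPn nx] := boolP [exists x, v == phi e x].
    right; apply: (@DelVertex _ _ _ _ x).
    + by rewrite inE -eqx.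
    + by rewrite -(phi_terminal e) -eqx.
    + by apply/setP => z; rewrite !inE eqv !inE eqx (inj_eq (@phi_inj e)).
    + by apply/setP => a; rewrite !inE eqe !inE eqx mem_imset.
  left; apply: graph_eq; apply/setP => z; rewrite !inE ?eqv ?eqe !inE.
    by rewrite eq_sym nx.
  rewrite andb_idr // => _; apply/imsetP => -[x _ eqx].
  by have := nx x; rewrite eqx eqxx.
- split=> [g|]; first by rewrite eqe inE => /andP[_ /inK].
  have [/existsP[a /eqP eqa]|/existsPn na] := boolP [exists a : {set V0}, f == phi e @: a].
    right; apply: (@DelEdge _ _ _ _ a); first by rewrite inE -eqa.
      by apply/setP => z; rewrite !inE eqv.
    apply/setP => b; rewrite !inE eqe !inE eqa.
    by rewrite (inj_eq (imset_inj (@phi_inj e))).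
  left; apply: graph_eq; apply/setP => z; rewrite !inE ?eqv ?eqe // !inE.
  by rewrite eq_sym na.
- have [e' [b eq_uv]] := inK _ uvK.
  have /imsetP[u0 _ eq_u] : u \in phi e' @: b by rewrite -eq_uv !inE eqxx.
  have /imsetP[v0 _ eq_v] : v \in phi e' @: b by rewrite -eq_uv !inE eqxx orbT.
  have v0T : v0 \notin T0 by rewrite -(phi_terminal e') -eq_v.
  (* All edges at the non-terminal [v] lie in [e'], so merging can only create edges of [e']. *)
  have edge_v f : f \in eset K -> v \in f -> exists a : {set V0}, f = phi e' @: a.
    move=> /inK[e1 [a ->]] /imsetP[w _ vw]; exists a.
    by rewrite (phi_private (etrans (esym eq_v) vw) v0T).
  have merge_copy f : f \in eset K -> v \in f ->
      exists a : {set V0}, Defs.merge u v @: f = phi e' @: (Defs.merge u0 v0 @: a).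
    move=> fK vf; have [a ->] := edge_v f fK vf; exists a.
    by rewrite eq_u eq_v merge_phi.
  split=> [f|].
    rewrite eqe => /imsetP[g]; rewrite inE => /andP[gK _] ->.
    have [vg|vg] := boolP (v \in g); last by rewrite merge_id //; apply: inK.
    by have [a ->] := merge_copy g gK vg; exists e', (Defs.merge u0 v0 @: a).
  have [eqe'|ne] := eqVneq e' e.
    right; subst e'; apply: (@ContractEdge _ _ _ _ u0 v0) => //.
    + by rewrite inE imsetU1 imset_set1 -eq_u -eq_v.
    + by apply/setP => z; rewrite !inE eqv !inE eq_v (inj_eq (@phi_inj e)).
    apply/setP => a; rewrite inE eqe; apply/imsetP/imsetP => -[f].
      rewrite inE => /andP[fK card_f] eq_a.
      have [a1 eq_f] : exists a1 : {set V0}, f = phi e @: a1.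
        have [vf|vf] := boolP (v \in f); first exact: edge_v.
        by exists a; rewrite eq_a merge_id.
      move: eq_a card_f; rewrite eq_f eq_u eq_v merge_phi card_imset // => eq_a card_f.
      exists a1; last exact: imset_inj eq_a.
      by rewrite !inE -eq_f fK.
    rewrite !inE => /andP[fK card_f] ->; exists (phi e @: f).
      by rewrite inE fK eq_u eq_v merge_phi card_imset.
    by rewrite eq_u eq_v merge_phi.
  left; apply: graph_eq; apply/setP => z; rewrite !inE ?eqv ?eqe ?inE.
    rewrite andb_idl // => _; apply: contra_neq ne => eq_z.
    exact: phi_private (etrans (esym eq_v) (esym eq_z)) v0T.
  have no_v f : f \in phi e @: [set: V0] -> f != v.
    move=> /imsetP[w _ ->]; apply: contra_neq ne => eq_w.
    exact: phi_private (etrans (esym eq_v) (esym eq_w)) v0T.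
  apply/imsetP/idP => [[f]|zK]; last first.
    exists (phi e @: z); last first.
      rewrite merge_id //; apply/negP => /imsetP[w _ eq_w].
      by have := no_v (phi e w) (imset_f _ (in_setT w)); rewrite eq_w eqxx.
    rewrite inE zK /= merge_id ?(edge_card zK) //; apply/negP => /imsetP[w _ eq_w].
    by have := no_v (phi e w) (imset_f _ (in_setT w)); rewrite eq_w eqxx.
  rewrite inE => /andP[fK /eqP card_f] eq_z.
  have [vf|vf] := boolP (v \in f); last by rewrite eq_z merge_id.
  have [a eq_a] := merge_copy f fK vf.
  (* A merged edge lies in [e']; if it also lay in [e], the two copies would share both of its
     endpoints. *)
  case/eqP: ne; apply: (copy_unique card_f (a := Defs.merge u0 v0 @: a) (a' := z)).
    by rewrite eq_a.
  by rewrite eq_z.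
Qed.

Lemma minor_copy e (G H : graph V) :
  in_copies G -> minor T H G -> in_copies H /\ minor T0 (copy e H) (copy e G).
Proof.
move=> inG mGH; elim: mGH inG => {G H} [G H stGH|G|G K H _ IHGK _ IHKH] inG.
- have [inH [->|stH]] := minor_step_copy e inG stGH; split=> //.
    exact: rt_refl.
  exact: rt_step.
- by split=> //; apply: rt_refl.
- have [inK mK] := IHGK inG; have [inH mH] := IHKH inK.
  by split=> //; apply: rt_trans mK mH.
Qed.

(** Otherwise every copy keeps a non-terminal, and choosing one in each copy is injective because
    non-terminals are private. *)
Lemma copy_without_nonterminals (H : graph V) :
  (#|vset H :\: T| < #|E|)%N -> exists e, vset (copy e H) \subset T0.
Proof.
move=> lt_card; apply/existsP; apply: contraLR lt_card => /existsPn noncov.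
have pickx e : {x | (phi e x \in vset H) && (x \notin T0)}.
  apply/sigW; have /subsetPn[x] := noncov e.
  by rewrite inE => xH xT; exists x; rewrite xH.
pose f e := phi e (sval (pickx e)).
have f_inj : injective f.
  move=> e e' /phi_private; apply.
  by case/andP: (svalP (pickx e)).
rewrite -leqNgt -cardsT -(card_imset _ f_inj) subset_leq_card //.
apply/subsetP => _ /imsetP[e _ ->]; have /andP[fH fT] := svalP (pickx e).
by rewrite inE phi_terminal fT.
Qed.

(** * Cutting walks into pieces inside single copies *)

Variable R : realType.
Implicit Type K : wgraph R V.

Fact copy_elen_gt0 e K (a : {set V0}) :
  a \in eset (copy e K) -> 0 < elen K (phi e @: a).
Proof. by rewrite inE; apply: elen_gt0. Qed.

Definition wcopy e K : wgraph R V0 :=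
  WGraph (elen := fun a => elen K (phi e @: a)) (@copy_elen_gt0 e K).

Lemma adj_wcopy e K x y : adj (wcopy e K) x y = adj K (phi e x) (phi e y).
Proof. by rewrite /adj inE imsetU1 imset_set1. Qed.

Lemma elen_wcopy e K x y :
  elen (wcopy e K) [set x; y] = elen K [set phi e x; phi e y].
Proof. by rewrite /= imsetU1 imset_set1. Qed.

Lemma has_walk_wcopy e K x y l :
  has_walk (wcopy e K) x y l -> has_walk K (phi e x) (phi e y) l.
Proof.
by apply: has_walk_map => u v; rewrite ?adj_wcopy // elen_wcopy.
Qed.

(** A walk cut at terminals into pieces that each stay in one copy. A piece may be closed, and
    successive pieces may use the same copy. *)
Inductive chain K : V -> V -> R -> Prop :=
| ChainNil p : chain K p p 0
| ChainCons e x x' a p l of x \in T0 & x' \in T0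
    & has_walk (wcopy e K) x x' a & chain K (phi e x') p l :
    chain K (phi e x) p (a + l).

(** The first piece is kept apart because [x] may be a non-terminal; it has length 0 when the first
    edge already leaves [e]. *)
Lemma walk_chain K e x p l :
  in_copies K -> p \in T -> has_walk K (phi e x) p l ->
  exists x' a b, [/\ x' \in T0, has_walk (wcopy e K) x x' a,
    chain K (phi e x') p b & a + b = l].
Proof.
move=> inK pT [w [pathw lastw <-]] {l}.
elim: w e x pathw lastw => [|v w IH] e x /=.
  move=> _ eq_p; exists x, 0, 0; split; rewrite ?addr0.
  - by rewrite -(phi_terminal e) eq_p.
  - exact: has_walk_refl.
  - by rewrite eq_p; apply: ChainNil.
  - by rewrite /walk_len /= big_nil.
case/andP=> xv pathw lastw; rewrite walk_len_cons.
have [e' [c eq_xv]] := inK _ xv.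
have /imsetP[y _ eq_x] : phi e x \in phi e' @: c by rewrite -eq_xv !inE eqxx.
have /imsetP[z _ eq_v] : v \in phi e' @: c by rewrite -eq_xv !inE eqxx orbT.
rewrite {}eq_v in xv pathw lastw *.
have [x' [a [b [x'T walk_a chain_b eq_ab]]]] := IH e' z pathw lastw.
have walk_y : has_walk (wcopy e' K) y x' (elen K [set phi e x; phi e' z] + a).
  rewrite eq_x -elen_wcopy; apply: has_walk_cons => //.
  by rewrite adj_wcopy -eq_x.
have [eq_e|ne] := eqVneq e e'.
  subst e'; exists x', (elen K [set phi e x; phi e z] + a), b; split=> //.
    by rewrite {1}(phi_inj eq_x).
  by rewrite -addrA eq_ab.
(* Different copies meet only in terminals, so the walk changes copy at one. *)
have xT : x \in T0 by apply: contraNT ne => /(phi_private eq_x)->.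
exists x, 0, (elen K [set phi e x; phi e' z] + a + b); split=> //.
- exact: has_walk_refl.
- have yT : y \in T0 by rewrite -(phi_terminal e') -eq_x phi_terminal.
  by rewrite [X in chain _ X]eq_x; apply: ChainCons chain_b.
- by rewrite add0r -addrA eq_ab.
Qed.

End Copies.

(** * The glued graph *)

Section Gluing.

Variables (R : realType) (V0 : finType) (G0 : wgraph R V0) (T0 : {set V0}).
Variables (q : nat) (gT : finGroupType) (s : 'I_q * V0 -> gT) (L : nat).
Hypothesis T0_sub : T0 \subset vset G0.
Hypothesis s_sq : forall c, (s c * s c = 1)%g.
Hypothesis s_inj : forall w w', reduced w -> reduced w' ->
  (size w <= L)%N -> (size w' <= L)%N -> word_val s w = word_val s w' -> w = w'.
Hypothesis L_ge2 : (2 <= L)%N.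

Local Notation copies := (gT * 'I_q)%type.
Local Notation V := (gT + copies * V0)%type.

(* The elements [inr (e, x)] with [x \in T0] are not vertices of the glued graph. *)
Definition glue_map (e : copies) (x : V0) : V :=
  if x \in T0 then inl (e.1 * s (e.2, x))%g else inr (e, x).

Definition glue_terminals : {set V} := [set v | if v is inl _ then true else false].

Lemma card_glue_terminals : #|glue_terminals| = #|gT|.
Proof.
rewrite -cardsT -(card_imset setT (f := @inl gT (copies * V0))); last by move=> x y [].
apply: eq_card => -[g|v]; rewrite inE; first by rewrite imset_f.
by apply/esym/imsetP => -[].
Qed.

Lemma s_injective c c' : s c = s c' -> c = c'.
Proof.
move=> eq_s; have [] // : [:: c] = [:: c'].
by apply: s_inj; rewrite //= ?eq_s // ltnW.
Qed.

Lemma glue_map_inj e : injective (glue_map e).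
Proof.
move=> x y; rewrite /glue_map; case: ifP; case: ifP => // _ _ [] //.
by move=> /mulgI/s_injective[].
Qed.

Lemma glue_map_terminal e x : (glue_map e x \in glue_terminals) = (x \in T0).
Proof. by rewrite inE /glue_map; case: ifP. Qed.

Lemma glue_map_private e e' x x' :
  glue_map e x = glue_map e' x' -> x \notin T0 -> e = e'.
Proof.
rewrite /glue_map => eq_xx' /negPf xT; move: eq_xx'.
by rewrite xT; case: ifP => // _ [].
Qed.

(** Two common terminals express [g^-1 * g'] as a product of two letters in two ways. If the letters
    of one product agree, then [g = g']; otherwise both are reduced words of length 2, and [L_ge2]
    makes them the same word, so [x1 = x2]. *)
Lemma glue_map_linear e e' x1 x2 x1' x2' :
  glue_map e x1 = glue_map e' x1' -> glue_map e x2 = glue_map e' x2' ->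
  x1 != x2 -> e = e'.
Proof.
move=> eq1 eq2 ne.
have [x1T|/(glue_map_private eq1)//] := boolP (x1 \in T0).
have [x2T|/(glue_map_private eq2)//] := boolP (x2 \in T0).
move: eq1 eq2; rewrite /glue_map x1T x2T; do 2!case: ifP => // _.
case: e e' => [g j] [g' j'] /= [eq1] [eq2].
have [eq_c|ne1] := eqVneq (j, x1) (j', x1').
  by move: eq_c eq1 => [<- <-] /mulIg ->.
have [eq_c|ne2] := eqVneq (j, x2) (j', x2').
  by move: eq_c eq2 => [<- <-] /mulIg ->.
have step c c' : (g * s c = g' * s c')%g -> (s c * s c' = g^-1 * g')%g.
  by move=> eq_c; apply: (mulgI g); rewrite mulKVg mulgA eq_c -mulgA s_sq mulg1.
have [_ eqx] : [:: (j', x1'); (j, x1)] = [:: (j', x2'); (j, x2)].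
  apply: s_inj; rewrite //= ?andbT 1?eq_sym //.
  by rewrite !mul1g (step _ _ eq1) (step _ _ eq2).
by rewrite eqx eqxx in ne.
Qed.

(** The terminals are added explicitly, so that they are vertices even when [T0] is empty. *)
Definition glue_vset : {set V} :=
  glue_terminals :|: \bigcup_(e : copies) (glue_map e @: vset G0).

Definition glue_eset : {set {set V}} :=
  \bigcup_(e : copies) [set glue_map e @: a | a : {set V0} in eset G0].

Fact glue_esetP : [forall f in glue_eset, (f \subset glue_vset) && (#|f| == 2)%N].
Proof.
apply/forall_inP => f /bigcupP[e _ /imsetP[a aG ->]].
rewrite card_imset ?(edge_card aG) ?andbT; last exact: glue_map_inj.
apply: subset_trans (imsetS _ (edge_subset aG)) _.
by rewrite subsetU // (bigcup_sup e) ?orbT.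
Qed.

(** An edge has a unique preimage in a unique copy, so the pick is determined; the default 1 keeps
    the length positive elsewhere. *)
Definition glue_len (f : {set V}) : R :=
  if [pick ea : copies * {set V0} | (ea.2 \in eset G0) &&
      (f == glue_map ea.1 @: ea.2)] is Some ea then elen G0 ea.2 else 1.

Lemma glue_len_gt0 f : 0 < glue_len f.
Proof.
by rewrite /glue_len; case: pickP => [ea /andP[aG _]|_]; rewrite ?ltr01 ?elen_gt0.
Qed.

Definition glued_graph : wgraph R V :=
  WGraph (wg_graph := Graph glue_esetP) (fun f _ => glue_len_gt0 f).

Lemma glue_edge_unique e e' (a a' : {set V0}) :
  a' \in eset G0 -> glue_map e @: a = glue_map e' @: a' -> e = e' /\ a = a'.
Proof.
move=> aG eqa; have eqe : e = e'.
  apply: (copy_unique glue_map_linear (f := glue_map e @: a)) (subxx _) _.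
    by rewrite eqa card_imset ?(edge_card aG) //; apply: glue_map_inj.
  by rewrite eqa.
by split=> //; subst e'; apply: imset_inj eqa; apply: glue_map_inj.
Qed.

Lemma mem_glue_eset e (a : {set V0}) :
  (glue_map e @: a \in eset glued_graph) = (a \in eset G0).
Proof.
apply/bigcupP/idP => [[e' _ /imsetP[a' aG /(glue_edge_unique aG)[_ ->//]]]|aG].
by exists e => //; apply: imset_f.
Qed.

Lemma elen_glued_graph e (a : {set V0}) :
  a \in eset G0 -> elen glued_graph (glue_map e @: a) = elen G0 a.
Proof.
move=> aG; rewrite /= /glue_len.
case: pickP => [[e' a'] /andP[/= aG' /eqP eqa]|/(_ (e, a))].
  by have [_ ->] := glue_edge_unique aG' eqa.
by rewrite /= aG eqxx.
Qed.

Lemma glued_graph_in_copies : in_copies glue_map glued_graph.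
Proof. by move=> f /bigcupP[e _ /imsetP[a _ ->]]; exists e, a. Qed.

Lemma glue_terminals_sub : glue_terminals \subset vset glued_graph.
Proof. exact: subsetUl. Qed.

Lemma copy_glued_graph e : copy glue_map_inj e glued_graph = G0.
Proof.
apply: graph_eq; apply/setP => x; rewrite inE; last exact: mem_glue_eset.
rewrite inE glue_map_terminal.
have [/(subsetP T0_sub)->//|xT /=] := boolP (x \in T0).
apply/bigcupP/idP => [[e' _ /imsetP[x' x'G eq_x]]|xG]; last first.
  by exists e; rewrite ?imset_f.
have eqe := glue_map_private eq_x xT.
by rewrite -eqe in eq_x; rewrite (glue_map_inj eq_x).
Qed.

Lemma has_walk_copy_glued_graph e x y l :
  has_walk (wcopy glue_map_inj e glued_graph) x y l <-> has_walk G0 x y l.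
Proof.
have adjE u v : adj (wcopy glue_map_inj e glued_graph) u v = adj G0 u v.
  by rewrite /adj inE mem_glue_eset.
have lenE u v : adj G0 u v ->
    elen (wcopy glue_map_inj e glued_graph) [set u; v] = elen G0 [set u; v].
  exact: elen_glued_graph.
by split; apply: has_walk_map => u v; rewrite ?adjE // => /lenE.
Qed.

Lemma dist_copy_glued_graph e x y :
  dist (wcopy glue_map_inj e glued_graph) x y = dist G0 x y.
Proof.
apply/eqP; rewrite eq_le; apply/andP; split; apply: le_dist => l walk_l.
  exact/dist_le_walk/has_walk_copy_glued_graph.
by apply: dist_le_walk; move/has_walk_copy_glued_graph: walk_l.
Qed.

(** * Retraction of short walks, for the glued graph and for its minors alike *)

Section ShortWalks.

Variables (K : wgraph R V) (d : R).
Hypothesis K_in_copies : in_copies glue_map K.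
Hypothesis d_gt0 : 0 < d.
Hypothesis K_sep : forall p p', p \in glue_terminals -> p' \in glue_terminals ->
  p != p' -> (d%:E <= dist K p p')%E.

Lemma hop_ge e x y a : x \in T0 -> y \in T0 -> x != y ->
  has_walk (wcopy glue_map_inj e K) x y a -> d <= a.
Proof.
move=> xT yT ne /has_walk_wcopy/dist_le_walk le_a.
rewrite -lee_fin; apply: le_trans le_a; apply: K_sep; rewrite ?glue_map_terminal //.
by rewrite (inj_eq (@glue_map_inj e)).
Qed.

(* Unfolding the walk in the free product and keeping the first letter of the
   current word retracts the walk onto the copy (g, j). *)
Lemma chain_retract p p' l : chain T0 glue_map_inj K p p' l ->
  forall g j u x, x \in T0 -> reduced (rcons u (j, x)) -> ~~ odd (size u) ->
  p = inl (g * word_val s (rcons u (j, x)))%g ->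
  exists u' x' l', [/\ reduced (rcons u' (j, x')),
    p' = inl (g * word_val s (rcons u' (j, x')))%g,
    (size u')%:R * d <= (size u)%:R * d + 2 * l,
    has_walk (wcopy glue_map_inj (g, j) K) x x' l' & l' <= l].
Proof.
elim=> {p p' l} [p|[g2 j2] x1 x2 a p l x1T x2T walk_a _ IH]
  g j u x xT red_u ev_u eq_p.
  by exists u, x, 0; split=> //; [rewrite mulr0 addr0 | apply: has_walk_refl].
have a_ge0 := has_walk_ge0 walk_a.
have [eq_x|ne] := eqVneq x1 x2.
  subst x2; have [u' [x' [l' [red_u' eq_p' size_u' walk_l' le_l']]]] :=
    IH g j u x xT red_u ev_u eq_p.
  by exists u', x', l'; split=> //; lra.
have a_ge : d <= a := hop_ge x1T x2T ne walk_a.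
set c := (j2, x1); set c' := (j2, x2).
have red_c := push_reduced c red_u.
have eq_g2 : g2 = (g * word_val s (push c (rcons u (j, x))))%g.
  move: eq_p; rewrite /glue_map x1T word_val_push // mulgA => -[<-].
  by rewrite -mulgA s_sq mulg1.
have eq_p2 : glue_map (g2, j2) x2 =
    inl (g * word_val s (push c' (push c (rcons u (j, x)))))%g.
  by rewrite /glue_map x2T word_val_push // mulgA -eq_g2.
have red_c' := push_reduced c' red_c.
have [[eq_u [eq_c push_c]]|[u1 push_c [ev_u1 size_u1]]] :=
  push_push_rcons c c' (j, x) ev_u.
  (* The word is the single letter [(j, x)] and gets cancelled: the piece runs inside [(g, j)], so
     it is kept and moves the first letter to [x2]. *)
  have [eq_j eq_x1] : j2 = j /\ x1 = x by case: eq_c.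
  subst j2 x1; rewrite push_c in red_c' eq_p2.
  have eq_g : g2 = g by rewrite eq_g2 eq_u /= eqxx mulg1.
  have [u' [x' [l' [red_u' eq_p' size_u' walk_l' le_l']]]] :=
    IH g j [::] x2 x2T red_c' isT eq_p2.
  exists u', x', (a + l'); split=> //; last by rewrite lerD2l.
    by move: size_u'; rewrite eq_u /=; lra.
  by apply: has_walk_trans walk_l'; rewrite -eq_g.
(* Otherwise the piece is an excursion: the first letter stays, and the retracted walk gains
   nothing. *)
rewrite push_c in red_c' eq_p2.
have [u' [x' [l' [red_u' eq_p' size_u' walk_l' le_l']]]] :=
  IH g j u1 x xT red_c' ev_u1 eq_p2.
exists u', x', l'; split=> //; last by lra.
(* At most two new letters are paid for by a piece of length at least [d], hence the factor 2 in the
   size bound. *)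
have : (size u1)%:R * d <= ((size u)%:R + 2) * d.
  by rewrite ler_pM2r // -natrD ler_nat.
by lra.
Qed.

(** The length bound keeps the final word within size [L], where its value determines it. As the
    value is that of the single letter [(j, t')], the retracted walk ends at [t']; the extra [d]
    accounts for that letter. *)
Lemma short_walk_copy e t t' l : t \in T0 -> t' \in T0 ->
  2 * l + d <= L%:R * d -> has_walk K (glue_map e t) (glue_map e t') l ->
  exists2 l', has_walk (wcopy glue_map_inj e K) t t' l' & l' <= l.
Proof.
case: e => g j tT t'T short walk_l.
have t'gT : glue_map (g, j) t' \in glue_terminals by rewrite glue_map_terminal.
have [x [a [b [xT walk_a chain_b eq_l]]]] :=
  walk_chain glue_map_inj glue_map_terminal glue_map_private K_in_copies t'gT walk_l.
have a_ge0 := has_walk_ge0 walk_a.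
have [||//|u [x' [l' [red_u eq_t' size_u walk_l' le_l']]]] :=
  chain_retract chain_b (g := g) (j := j) (u := [::]) xT => //.
  by rewrite /glue_map xT /= mul1g.
have : rcons u (j, x') = [:: (j, t')].
  apply: s_inj => //; last 2 first.
  - by rewrite ltnW.
  - by move: eq_t'; rewrite /glue_map t'T /= mul1g => -[/mulgI->].
  rewrite size_rcons -(ler_nat R) -(ler_pM2r d_gt0) -natr1.
  by move: size_u => /=; lra.
case: u {red_u eq_t' size_u} => [[eq_x']|c [|c' u]] //.
subst x'; exists (a + l'); last by lra.
exact: has_walk_trans walk_a walk_l'.
Qed.

Lemma dist_copy_le e t t' (D : R) : t \in T0 -> t' \in T0 ->
  2 * D + d <= L%:R * d -> (dist K (glue_map e t) (glue_map e t') < D%:E)%E ->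
  (dist (wcopy glue_map_inj e K) t t' <= dist K (glue_map e t) (glue_map e t'))%E.
Proof.
move=> tT t'T short lt_D.
have bound l : l <= D -> has_walk K (glue_map e t) (glue_map e t') l ->
    (dist (wcopy glue_map_inj e K) t t' <= l%:E)%E.
  move=> le_lD walk_l; have short_l : 2 * l + d <= L%:R * d by lra.
  have [l' /dist_le_walk le_l' le_l'l] := short_walk_copy tT t'T short_l walk_l.
  by apply: le_trans le_l' _; rewrite lee_fin.
apply: le_dist => l walk_l; have [le_lD|/ltW lt_Dl] := leP l D; first exact: bound.
(* A walk longer than [D] can be replaced by one shorter than [D], which [lt_D] provides. *)
have [m walk_m] := dist_lt_walk lt_D; rewrite lte_fin => /ltW lt_mD.
by apply: le_trans (bound m lt_mD walk_m) _; rewrite lee_fin; lra.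
Qed.

End ShortWalks.

Lemma DAM_of_glued_graph (alpha d D : R) (H : wgraph R V) :
  0 < alpha -> 0 < d -> (forall f, f \in eset G0 -> d <= elen G0 f) ->
  0 < D -> (forall x y, dist G0 x y <> +oo%E -> (dist G0 x y <= D%:E)%E) ->
  2 * (D + alpha * D + 1) + d <= L%:R * d ->
  is_DAM glue_terminals alpha glued_graph H ->
  (#|vset H :\: glue_terminals| < #|{: copies}|)%N ->
  exists2 H0, is_DAM T0 alpha G0 H0 & vset H0 \subset T0.
Proof.
(* [B] exceeds both [D], for distances in the glued graph, and [alpha * D], for those in the
   minor. *)
set B := D + alpha * D + 1.
move=> alpha_gt0 d_gt0 le_d D_gt0 le_D short [minH distH] cardH.
have aD_gt0 : 0 < alpha * D by rewrite mulr_gt0.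
have [e eT0] := copy_without_nonterminals glue_map_inj glue_map_terminal
  glue_map_private cardH.
have [inH min0] := minor_copy glue_map_inj glue_map_terminal glue_map_private
  glue_map_linear e glued_graph_in_copies minH.
rewrite copy_glued_graph in min0.
exists (wcopy glue_map_inj e H); last exact: eT0.
split=> // t t' tT t'T.
have sepG p p' : p \in glue_terminals -> p' \in glue_terminals ->
    p != p' -> (d%:E <= dist glued_graph p p')%E.
  move=> _ _; apply: dist_ge_edge => f /bigcupP[e' _ /imsetP[a aG ->]].
  by rewrite elen_glued_graph // le_d.
have sepH p p' : p \in glue_terminals -> p' \in glue_terminals ->
    p != p' -> (d%:E <= dist H p p')%E.
  by move=> pT p'T ne; apply: le_trans (sepG _ _ pT p'T ne) (distH _ _ pT p'T).1.
have [] := distH (glue_map e t) (glue_map e t'); rewrite ?glue_map_terminal //.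
set p := glue_map e t; set p' := glue_map e t' => le_GH le_HG.
(* Infinite distances are not covered by [D], but a minor cannot connect separate components. *)
have [oo|noo] := pselect (dist G0 t t' = +oo%E).
  have nc : ~~ connect (adj (wcopy glue_map_inj e H)) t t'.
    by apply: contra (dist_pinfty_connect oo); apply: minor_connect min0.
  by rewrite oo (dist_pinfty nc) gt0_muley ?lte_fin.
have le_tt' := le_D _ _ noo.
have le_GG0 : (dist glued_graph p p' <= dist G0 t t')%E.
  apply: le_dist => l /(has_walk_copy_glued_graph e) walk_l.
  by apply: dist_le_walk; apply: has_walk_wcopy walk_l.
have lt_GB : (dist glued_graph p p' < B%:E)%E.
  by apply: le_lt_trans (le_trans le_GG0 le_tt') _; rewrite lte_fin /B; lra.
have le_HG0 : (dist H p p' <= alpha%:E * dist G0 t t')%E.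
  by apply: le_trans le_HG _; rewrite lee_pmul2l // lte_fin.
have lt_HB : (dist H p p' < B%:E)%E.
  apply: (le_lt_trans le_HG0); apply: (@le_lt_trans _ _ (alpha * D)%:E).
    by rewrite EFinM lee_pmul2l // lte_fin.
  by rewrite lte_fin /B; lra.
split.
  (* The lower bound retracts walks of the glued graph; the upper bound below retracts walks of
     [H]. *)
  apply: (@le_trans _ _ (dist H p p')).
    apply: le_trans le_GH; rewrite -(dist_copy_glued_graph e).
    exact: (dist_copy_le glued_graph_in_copies d_gt0 sepG tT t'T short lt_GB).
  by apply: le_dist => l /has_walk_wcopy; apply: dist_le_walk.
apply: le_trans le_HG0.
exact: (dist_copy_le inH d_gt0 sepH tT t'T short lt_HB).
Qed.

End Gluing.

(** * Choice of the constants and conclusion *)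

Lemma finite_upper_bound (R : realType) (I : finType) (f : I -> R) :
  exists2 M, 0 < M & forall i, f i <= M.
Proof.
exists (1 + \sum_i `|f i|) => [|i]; first by rewrite ltr_wpDr ?sumr_ge0.
rewrite (bigD1 i) //= ler_wpDl // ler_wpDr ?sumr_ge0 //; exact: ler_norm.
Qed.

Lemma edge_lower_bound (R : realType) (V : finType) (G : wgraph R V) :
  exists2 d, 0 < d & forall f, f \in eset G -> d <= elen G f.
Proof.
have [M M_gt0 le_M] := finite_upper_bound (fun f => (elen G f)^-1).
exists M^-1 => [|f fG]; first by rewrite invr_gt0.
by rewrite -[elen G f]invrK lef_pV2 ?posrE ?invr_gt0 // elen_gt0.
Qed.

Lemma dist_upper_bound (R : realType) (V : finType) (G : wgraph R V) :
  exists2 D, 0 < D & forall x y, dist G x y <> +oo%E -> (dist G x y <= D%:E)%E.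
Proof.
have [D D_gt0 le_D] := finite_upper_bound (fun xy => fine (dist G xy.1 xy.2)).
exists D => // x y; have := le_D (x, y) => /=.
by case: (dist G x y) => //= *; rewrite leNye.
Qed.

Theorem theorem3p13 (R : realType) :
  SPR_superconstant R <-> (forall y : R, 0 <= y -> LSPR_superconstant y).
Proof.
split=> [spr y y_ge0 alpha alpha_gt0|lspr]; last exact: (lspr 0).
have [V0 [G0 [T0 [T0_sub noH]]]] := spr alpha alpha_gt0.
have [d d_gt0 le_d] := edge_lower_bound G0.
have [D D_gt0 le_D] := dist_upper_bound G0.
pose B := 2 * (D + alpha * D + 1) + d.
have [L [L_ge2 short]] : exists L : nat, (2 <= L)%N /\ B <= L%:R * d.
  exists (Num.bound (B / d)).+2; split=> //.
  rewrite -ler_pdivrMr //; apply: le_trans (ltW (archi_boundP _)) _.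
    have : 0 < alpha * D by rewrite mulr_gt0.
    by move=> aD_gt0; rewrite divr_ge0 ?ltW // /B; lra.
  by rewrite ler_nat -[X in (_ <= X)%N]addn2 leq_addr.
pose q := Num.bound y.
have s_sq := @ball_perm_sq ('I_q * V0)%type L.
have s_inj := @word_val_ball_inj ('I_q * V0)%type L.
exists _, (glued_graph G0 T0 s_inj L_ge2), (glue_terminals V0 q _).
split=> [|[H [damH cardH]]]; first exact: glue_terminals_sub.
apply: noH.
have [|H0 damH0 H0_sub] :=
  DAM_of_glued_graph T0_sub s_sq alpha_gt0 d_gt0 le_d D_gt0 le_D short damH.
  (* There are [q] copies per terminal and [y < q], so the remaining non-terminals are fewer than
     the copies. *)
  rewrite -(ltr_nat R); apply: le_lt_trans cardH _.
  rewrite card_glue_terminals card_prod card_ord natrM mulrC ltr_pM2l.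
    exact: archi_boundP.
  by rewrite ltr0n; apply/card_gt0P; exists 1%g.
exists H0; split=> //.
by rewrite mul0r (_ : _ :\: _ = set0) ?cards0 //; apply/eqP; rewrite setD_eq0.
Qed.
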